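(* The Set-Fmla logic $\mathcal{PP}^{\Rightarrow_H}_{\top}$ has the extension interpolation property (EIP), the Craig interpolation property (CIP) and the Maehara interpolation property (MIP).
   Context: $\mathbf{PP}_6^{\Rightarrow_H}$ is the algebra in signature $\Sigma=\{\land,\lor,\Rightarrow,{\sim},\circ,\bot,\top\}$ with carrier $\mathcal V_6=\{\hat{\mathbf f},\mathbf f,\mathbf n,\mathbf b,\mathbf t,\hat{\mathbf t}\}$ ordered by $\hat{\mathbf f}<\mathbf f<\mathbf n<\mathbf t<\hat{\mathbf t}$, $\mathbf f<\mathbf b<\mathbf t$, $\mathbf n,\mathbf b$ incomparable; $\land,\lor$ meet and join, $\bot=\hat{\mathbf f}$, $\top=\hat{\mathbf t}$, ${\sim}$ swaps $\mathbf f\leftrightarrow\mathbf t$, $\hat{\mathbf f}\leftrightarrow\hat{\mathbf t}$ and fixes $\mathbf n,\mathbf b$; $\circ a=\hat{\mathbf t}$ if $a\in\{\hat{\mathbf f},\hat{\mathbf t}\}$, else $\hat{\mathbf f}$; $a\Rightarrow b=\max\{c: a\land c\le b\}$. $\mathcal{PP}^{\Rightarrow_H}_{\top}$ is the $\top$-assertional logic of the variety $\mathbb V(\mathbf{PP}_6^{\Rightarrow_H})$: $\Phi\vdash\psi$ iff for every $\mathbf A\in\mathbb V(\mathbf{PP}_6^{\Rightarrow_H})$ and homomorphism $h$ from formulas to $\mathbf A$, $h(\Phi)\subseteq\{\top^{\mathbf A}\}$ implies $h(\psi)=\top^{\mathbf A}$. For a set $S$ of variables, $L(S)$ denotes the set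 of $\Sigma$-formulas whose variables lie in $S$; $\mathsf{props}(\Gamma)$ is the set of variables occurring in $\Gamma$. A Set-Fmla logic $\vdash$ has: (EIP) if $\Phi\cup\Psi\vdash\varphi$ implies there is $\Pi\subseteq L(\mathsf{props}(\Psi\cup\{\varphi\}))$ with $\Phi\vdash\pi$ for all $\pi\in\Pi$ and $\Pi\cup\Psi\vdash\varphi$; (CIP) if, whenever $\mathsf{props}(\Phi)\cap\mathsf{props}(\varphi)\ne\varnothing$, $\Phi\vdash\varphi$ implies there is $\Pi\subseteq L(\mathsf{props}(\Phi)\cap\mathsf{props}(\varphi))$ with $\Phi\vdash\pi$ for all $\pi\in\Pi$ and $\Pi\vdash\varphi$; (MIP) if, whenever $\mathsf{props}(\Phi)\cap\mathsf{props}(\Psi\cup\{\varphi\})\ne\varnothing$, $\Phi\cup\Psi\vdash\varphi$ implies there is $\Pi\subseteq L(\mathsf{props}(\Phi)\cap\mathsf{props}(\Psi\cup\{\varphi\}))$ with $\Phi\vdash\pi$ for all $\pi\in\Pi$ and $\Pi\cup\Psi\vdash\varphi$. *)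

(* Defs.v *)
From mathcomp Require Import all_boot.
From mathcomp Require Import boolp classical_sets.
Set Implicit Arguments.
Unset Strict Implicit.
Unset Printing Implicit Defensive.
Local Open Scope classical_set_scope.

Record algebra := Algebra {
  carrier :> Type;
  meet : carrier -> carrier -> carrier;
  join : carrier -> carrier -> carrier;
  impl : carrier -> carrier -> carrier;
  neg : carrier -> carrier;
  circ : carrier -> carrier;
  bot : carrier;
  top : carrier
}.
Arguments bot A : rename.
Arguments top A : rename.

Record is_hom (A B : algebra) (h : A -> B) : Prop := IsHom {
  hom_meet : forall x y, h (meet x y) = meet (h x) (h y);
  hom_join : forall x y, h (join x y) = join (h x) (h y);
  hom_impl : forall x y, h (impl x y) = impl (h x) (h y);
  hom_neg : forall x, h (neg x) = neg (h x);
  hom_circ : forall x, h (circ x) = circ (h x);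
  hom_bot : h (bot A) = bot B;
  hom_top : h (top A) = top B
}.

Definition prod_algebra (I : Type) (A : I -> algebra) : algebra :=
  @Algebra (forall i, A i)
    (fun x y i => meet (x i) (y i))
    (fun x y i => join (x i) (y i))
    (fun x y i => impl (x i) (y i))
    (fun x i => neg (x i))
    (fun x i => circ (x i))
    (fun i => bot (A i))
    (fun i => top (A i)).

(* The variety generated by K: the least class of algebras that contains K
   and is closed under homomorphic images, subalgebras (up to isomorphism,
   i.e. domains of embeddings) and direct products of arbitrary families. *)
Inductive variety (K : algebra -> Prop) : algebra -> Prop :=
| variety_gen (A : algebra) : K A -> variety K A
| variety_H (A B : algebra) (h : A -> B) :
    is_hom h -> (forall y : B, exists x : A, h x = y) ->
    variety K A -> variety K B
| variety_S (A B : algebra) (h : B -> A) :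
    is_hom h -> injective h -> variety K A -> variety K B
| variety_P (I : Type) (A : I -> algebra) :
    (forall i, variety K (A i)) -> variety K (prod_algebra A).

(* fh and th stand for the hatted (least and greatest) values. *)
Inductive V6 : Set := fh | ff | nn | bb | tt | th.

Definition le6 (x y : V6) : bool :=
  match x, y with
  | fh, _ | _, th => true
  | ff, (ff | nn | bb | tt) => true
  | nn, (nn | tt) => true
  | bb, (bb | tt) => true
  | tt, tt => true
  | _, _ => false
  end.

Definition meet6 (x y : V6) : V6 :=
  if le6 x y then x else if le6 y x then y else ff.

Definition join6 (x y : V6) : V6 :=
  if le6 x y then y else if le6 y x then x else tt.

(* See impl6_max. *)
Definition impl6 (x y : V6) : V6 :=
  match x, y with
  | nn, ff => bb
  | bb, ff => nn
  | _, _ => if le6 x y then th else y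
  end.

Definition neg6 (x : V6) : V6 :=
  match x with
  | fh => th | ff => tt | nn => nn | bb => bb | tt => ff | th => fh
  end.

Definition circ6 (x : V6) : V6 :=
  match x with fh | th => th | _ => fh end.

Lemma le6_refl x : le6 x x.
Proof. by case: x. Qed.

Lemma le6_anti x y : le6 x y -> le6 y x -> x = y.
Proof. by case: x; case: y. Qed.

Lemma le6_trans x y z : le6 x y -> le6 y z -> le6 x z.
Proof. by case: x; case: y; case: z. Qed.

Lemma meet6_glb x y z : le6 z (meet6 x y) = le6 z x && le6 z y.
Proof. by case: x; case: y; case: z. Qed.

Lemma join6_lub x y z : le6 (join6 x y) z = le6 x z && le6 y z.
Proof. by case: x; case: y; case: z. Qed.

Lemma impl6_max x y :
  le6 (meet6 x (impl6 x y)) y /\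
  (forall z, le6 (meet6 x z) y -> le6 z (impl6 x y)).
Proof. by split; [case: x; case: y | move=> z; case: x; case: y; case: z]. Qed.

Definition PP6H : algebra :=
  @Algebra V6 meet6 join6 impl6 neg6 circ6 fh th.

Inductive form : Set :=
| Var of nat
| And of form & form
| Or of form & form
| Imp of form & form
| Neg of form
| Circ of form
| Bot
| Top.

Definition form_algebra : algebra := @Algebra form And Or Imp Neg Circ Bot Top.

Fixpoint vars (phi : form) : set nat :=
  match phi with
  | Var p => [set p]
  | And a b | Or a b | Imp a b => vars a `|` vars b
  | Neg a | Circ a => vars a
  | Bot | Top => set0
  end.

Definition props (Gamma : set form) : set nat := \bigcup_(phi in Gamma) vars phi.

Definition L (S : set nat) : set form := [set phi | vars phi `<=` S].

Definition top_assertional (K : algebra -> Prop) (Phi : set form) (psi : form) :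
    Prop :=
  forall A : algebra, K A ->
  forall h : form_algebra -> A, is_hom h ->
  h @` Phi `<=` [set top A] -> h psi = top A.

Definition PPH_top : set form -> form -> Prop :=
  top_assertional (variety (fun A => A = PP6H)).

Definition EIP (entails : set form -> form -> Prop) : Prop :=
  forall (Phi Psi : set form) (phi : form),
  entails (Phi `|` Psi) phi ->
  exists Pi : set form,
    [/\ Pi `<=` L (props (Psi `|` [set phi])),
        forall pi, Pi pi -> entails Phi pi
      & entails (Pi `|` Psi) phi].

Definition CIP (entails : set form -> form -> Prop) : Prop :=
  forall (Phi : set form) (phi : form),
  props Phi `&` props [set phi] !=set0 ->
  entails Phi phi ->
  exists Pi : set form,
    [/\ Pi `<=` L (props Phi `&` props [set phi]),
        forall pi, Pi pi -> entails Phi pi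
      & entails Pi phi].

Definition MIP (entails : set form -> form -> Prop) : Prop :=
  forall (Phi Psi : set form) (phi : form),
  props Phi `&` props (Psi `|` [set phi]) !=set0 ->
  entails (Phi `|` Psi) phi ->
  exists Pi : set form,
    [/\ Pi `<=` L (props Phi `&` props (Psi `|` [set phi])),
        forall pi, Pi pi -> entails Phi pi
      & entails (Pi `|` Psi) phi].

(* Main.v *)
Require Import Defs.
From Stdlib Require List.
From mathcomp Require Import all_boot.
From mathcomp Require Import boolp classical_sets.
Set Implicit Arguments.
Unset Strict Implicit.
Unset Printing Implicit Defensive.
Local Open Scope classical_set_scope.

(** Put [delta x := x /\ circ x].  On [PP6H] it sends [th] to [th] and every
    other value to [fh], so "if [a] is designated then [b] is" is expressed by
    the term [delta a => b].  Together with compactness of the finite matrix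
    [(PP6H, {th})] this shows that [PPH_top] is the consequence relation of that
    single matrix, because identities of [PP6H] persist in its variety.

    As interpolant take all consequences of [Phi] in the shared variables [S].
    If [v] is a valuation designating these and [Psi], but not [phi], then by
    compactness some model [w] of [Phi] designates exactly the same formulas
    over [S] as [v].  The values [fh], [ff], [tt], [th] are then the same on
    [S], and [nn], [bb] are the same up to the automorphism of [PP6H] that
    swaps them.  After applying this automorphism to [w], the valuation that is
    [w] on the variables of [Phi] and [v] elsewhere refutes [Phi, Psi |- phi]. *)

(** * Evaluation of formulas and identities in a generated variety *)

Fixpoint eval (A : algebra) (v : nat -> A) (phi : form) : A :=
  match phi with
  | Var p => v p
  | And a b => meet (eval v a) (eval v b)
  | Or a b => join (eval v a) (eval v b)
  | Imp a b => impl (eval v a) (eval v b)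
  | Neg a => neg (eval v a)
  | Circ a => circ (eval v a)
  | Bot => bot A
  | Top => top A
  end.

Lemma eval_is_hom (A : algebra) (v : nat -> A) :
  @is_hom form_algebra A (eval v).
Proof. by []. Qed.

Lemma hom_eval (A B : algebra) (h : A -> B) (v : nat -> A) phi :
  is_hom h -> h (eval v phi) = eval (h \o v) phi.
Proof.
case=> hM hJ hI hN hC hB hT.
by elim: phi => //= [a <- b <-|a <- b <-|a <- b <-|a <-|a <-].
Qed.

Lemma form_hom_eval (A : algebra) (h : form_algebra -> A) phi :
  is_hom h -> h phi = eval (h \o Var) phi.
Proof.
move=> hh; rewrite -(@hom_eval form_algebra A h Var phi hh); congr h.
by elim: phi => //= [a <- b <-|a <- b <-|a <- b <-|a <-|a <-].
Qed.

Lemma eval_prod (I : Type) (A : I -> algebra) (v : nat -> prod_algebra A) phi i :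
  eval v phi i = eval (fun p => v p i) phi.
Proof. by elim: phi => //= [a -> b ->|a -> b ->|a -> b ->|a ->|a ->]. Qed.

Lemma eq_eval (A : algebra) (u v : nat -> A) phi :
  (forall p, vars phi p -> u p = v p) -> eval u phi = eval v phi.
Proof.
elim: phi => //= [p -> //|a IHa b IHb|a IHa b IHb|a IHa b IHb|a IHa|a IHa] uv;
  by rewrite ?IHa ?IHb // => p pv; apply: uv => //; (left + right).
Qed.

(** The easy half of Birkhoff's theorem: a valuation lifts along a surjection, an embedding reflects
    equations, and products are computed coordinatewise. *)
Lemma variety_identity (K : algebra -> Prop) phi psi :
  (forall A, K A -> forall v : nat -> A, eval v phi = eval v psi) ->
  forall A, variety K A -> forall v : nat -> A, eval v phi = eval v psi.
Proof.
move=> Keq A; elim=> {A} [|A B h hh hsurj _ IH v|A B h hh hinj _ IH v|I A _ IH v].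
- exact: Keq.
- have [u uv] := choice (fun p => hsurj (v p)).
  have -> : v = h \o u by apply: funext => p /=; rewrite uv.
  by rewrite -!hom_eval // IH.
- by apply: hinj; rewrite !hom_eval // IH.
- by apply: functional_extensionality_dep => i; rewrite !eval_prod IH.
Qed.

Notation ev := (@eval PP6H).

Definition models (v : nat -> V6) (Gamma : set form) : Prop :=
  forall g, Gamma g -> ev v g = th.

Definition consequence (Phi : set form) (psi : form) : Prop :=
  forall v, models v Phi -> ev v psi = th.

Definition in_list (G : seq form) : set form := fun g => List.In g G.

Lemma vars_bounded phi : exists n, forall p, vars phi p -> p < n.
Proof.
have U (A B : set nat) : (exists n, forall p, A p -> p < n) ->
    (exists n, forall p, B p -> p < n) ->
    exists n, forall p, (A `|` B) p -> p < n.
  move=> [m Am] [n Bn]; exists (maxn m n) => p.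
  by rewrite leq_max => -[/Am ->|/Bn ->]; rewrite ?orbT.
elim: phi => //= [p|a ? b ?|a ? b ?|a ? b ?||]; [|exact: U..|by exists 0|by exists 0].
by exists p.+1 => q ->.
Qed.

(** * Compactness *)

(** Only the values of [v] below [n] matter: a total function encodes a node of depth [n] in the
    tree of partial valuations. *)
Definition fin_sat_from (Gamma : set form) (n : nat) (v : nat -> V6) : Prop :=
  forall G : seq form, in_list G `<=` Gamma ->
  exists u, (forall i, i < n -> u i = v i) /\ models u (in_list G).

Definition update (v : nat -> V6) n x : nat -> V6 :=
  fun i => if i == n then x else v i.

(** If all six values failed at [n], six finite lists would witness this; a model of their
    concatenation takes one of these values at [n], a contradiction. *)
Lemma fin_sat_from_extend Gamma n v :
  fin_sat_from Gamma n v -> exists x, fin_sat_from Gamma n.+1 (update v n x).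
Proof.
move=> sat; apply: contrapT => /forallNP nosat.
have /choice[G HG] : forall x, exists G : seq form, in_list G `<=` Gamma /\
    forall u, (forall i, i < n.+1 -> u i = update v n x i) ->
      ~ models u (in_list G).
  move=> x; have /existsNP[G /not_implyP[GG nex]] := nosat x.
  by exists G; split=> // u uv mu; apply: nex; exists u.
pose F := G fh ++ G ff ++ G nn ++ G bb ++ G tt ++ G th.
have FP g : List.In g F <-> exists x, List.In g (G x).
  rewrite /F !List.in_app_iff; split=> [|[[]]]; [|tauto..].
  by do ?[case=> [?|]]; [exists fh|exists ff|exists nn|exists bb|exists tt|exists th].
have [|u [uv um]] := sat F.
  by move=> g /FP[x] /(proj1 (HG x)).
apply: (proj2 (HG (u n)) u) => [i|g gG]; last by apply: um; apply/FP; exists (u n).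
rewrite ltnS /update; case: eqP => [-> //|/eqP ne le_in].
by apply: uv; rewrite ltn_neqAle ne.
Qed.

(* König's lemma on the tree of finite partial valuations. *)
Lemma compactness Gamma :
  (forall G : seq form, in_list G `<=` Gamma -> exists v, models v (in_list G)) ->
  exists v, models v Gamma.
Proof.
move=> sat.
have /choice[next nextP] : forall nv : nat * (nat -> V6), exists x,
    fin_sat_from Gamma nv.1 nv.2 ->
    fin_sat_from Gamma nv.1.+1 (update nv.2 nv.1 x).
  move=> [n v] /=; case: (pselect (fin_sat_from Gamma n v)) => [s|ns].
    by have [x xP] := fin_sat_from_extend s; exists x.
  by exists th.
pose approx := fix approx n : nat -> V6 :=
  if n is m.+1 then update (approx m) m (next (m, approx m)) else fun=> th.
have approxP n : fin_sat_from Gamma n (approx n).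
  elim: n => [G GG|n IH]; last exact: (nextP (n, approx n) IH).
  by have [v vG] := sat G GG; exists v.
have approxE m n : m < n -> approx n m = approx m.+1 m.
  elim: n => // n IH; rewrite ltnS leq_eqVlt => /orP[/eqP -> //|mn].
  by rewrite -IH //= /update ltn_eqF.
(* The value at [p] is fixed from stage [p.+1] on, so this limit agrees with [approx n] below
   [n]. *)
exists (fun p => approx p.+1 p) => g Gg.
have [n nP] := vars_bounded g.
have [|u [uv um]] := approxP n [:: g]; first by move=> x [<-|].
rewrite -(um g); last by left.
by apply: eq_eval => p /nP pn; rewrite uv // approxE.
Qed.

(** * Reduction to the six-element matrix *)

Definition delta (a : form) : form := And a (Circ a).

Definition big_and (G : seq form) : form := foldr And Top G.

Lemma eval_big_and v G : ev v (big_and G) = th <-> models v (in_list G).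
Proof.
elim: G => [|g G IH] /=; first by split=> // _ ? [].
have -> : meet6 (ev v g) (ev v (big_and G)) = th <->
    ev v g = th /\ ev v (big_and G) = th.
  by case: (ev v g); case: (ev v (big_and G)); split=> // -[].
by split=> [[gt /IH m] x [<- //|/m //]|m]; split;
  [apply: m; left|apply/IH => x xG; apply: m; right].
Qed.

Lemma eval_delta_imp v a b :
  ev v (Imp (delta a) b) = th <-> (ev v a = th -> ev v b = th).
Proof.
by rewrite /=; case: (ev v a); case: (ev v b); split=> // ->.
Qed.

(** If every [G] failed, each finite part of [Phi], [Theta] and [nt] would have a model: take the
    valuation refuting the [G] formed by its members from [Theta]. Compactness then contradicts the
    assumption. *)
Lemma consequence_deduction Phi Theta psi :
  consequence (Phi `|` Theta) psi ->
  exists G : seq form,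
    in_list G `<=` Theta /\ consequence Phi (Imp (delta (big_and G)) psi).
Proof.
move=> cons; apply: contrapT => /forallNP noG.
pose nt := Imp (delta psi) Bot.
have ntP v : ev v nt = th <-> ev v psi <> th.
  by rewrite eval_delta_imp; split=> [H /H|].
have [F Fsub|v vm] := @compactness (Phi `|` Theta `|` [set nt]).
  have [G [GT FG]] : exists G, in_list G `<=` Theta /\
      in_list F `<=` Phi `|` in_list G `|` [set nt].
    elim: F Fsub => [|f F IH] Fsub; first by exists [::]; split=> ? [].
    have [|G [GT FG]] := IH; first by move=> x xF; apply: Fsub; right.
    have [[fPhi|fT]|fn] := Fsub f (or_introl erefl).
    - by exists G; split=> // x [<-|/FG //]; left; left.
    - exists (f :: G); split=> [x [<- //|/GT //]|x [<-|/FG[[]|]]].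
      + by left; right; left.
      + by left; left.
      + by left; right; right.
      + by right.
    - by exists G; split=> // x [<-|/FG //]; right.
  have /existsNP[v /not_implyP[vPhi nv]] : ~ consequence Phi (Imp (delta (big_and G)) psi).
    by move=> c; apply: (noG G).
  move: nv; rewrite eval_delta_imp => /not_implyP[/eval_big_and vG vpsi].
  by exists v => f /FG[[/vPhi|/vG]|->] //; apply/ntP.
have : ev v psi <> th by apply/ntP; apply: vm; right.
by apply; apply: cons => g gP; apply: vm; left.
Qed.

Lemma PPH_topE Phi psi : PPH_top Phi psi <-> consequence Phi psi.
Proof.
split=> [ent v vm|cons A VA h hh hPhi].
  apply: (ent PP6H (variety_gen erefl) (ev v) (eval_is_hom _)).
  by move=> _ [g /vm gt <-].
(* All premises move into one formula, whose validity is an identity and hence transfers to [A]. *)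
have [|G [GPhi valid]] := @consequence_deduction set0 Phi psi.
  by rewrite set0U.
have idA chi chi' : (forall v, ev v chi = ev v chi') ->
    forall v : nat -> A, eval v chi = eval v chi'.
  by move=> eqv; apply: variety_identity VA => _ -> v; apply: eqv.
set v : nat -> A := h \o Var.
have conjT : eval v (big_and G) = top A.
  elim: G GPhi {valid} => //= g G IH GPhi.
  rewrite IH => [|x xG]; last by apply: GPhi; right.
  rewrite -form_hom_eval // (hPhi (h g)); last by exists g => //; apply: GPhi; left.
  exact: (idA (And Top Top) Top).
have impT : eval v (Imp (delta (big_and G)) psi) = top A.
  by apply: (idA _ Top) => u; apply: valid => ? [].
rewrite form_hom_eval //.
(* This identity detaches [psi] inside [A]. *)
have <- : eval v (Imp (delta Top) psi) = eval v psi.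
  by apply: idA => u /=; case: (ev u psi).
by rewrite -impT /= conjT.
Qed.

(** * Interpolation *)

Definition swap6 (x : V6) : V6 :=
  match x with nn => bb | bb => nn | _ => x end.

Lemma swap6_is_hom : @is_hom PP6H PP6H swap6.
Proof. by split=> //=; do ?case. Qed.

Lemma eval_swap6 v phi : (ev (swap6 \o v) phi = th) <-> (ev v phi = th).
Proof.
by rewrite -(@hom_eval PP6H PP6H swap6 v phi swap6_is_hom); case: (ev v phi).
Qed.

(** The formulas [p], [~p], [p => ~p], [~p => p] separate all values except [nn] from [bb]; the
    formulas [p => q] force one choice of swap for all variables. *)
Lemma same_theory_up_to_swap (S : set nat) (v w : nat -> V6) :
  (forall a, L S a -> (ev v a = th <-> ev w a = th)) ->
  (forall p, S p -> w p = v p) \/ (forall p, S p -> swap6 (w p) = v p).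
Proof.
move=> same.
have orbit p : S p -> w p = v p \/ swap6 (w p) = v p.
  move=> Sp.
  have sub a : vars a `<=` [set p] -> L S a by move=> ap q /ap ->.
  have /= s1 := same (Var p) (sub (Var p) (fun _ => id)).
  have /= s2 := same (Neg (Var p)) (sub (Neg (Var p)) (fun _ => id)).
  have /= s3 : ev v (Imp (Var p) (Neg (Var p))) = th <->
               ev w (Imp (Var p) (Neg (Var p))) = th.
    by apply/same/sub => q [].
  have /= s4 : ev v (Imp (Neg (Var p)) (Var p)) = th <->
               ev w (Imp (Neg (Var p)) (Var p)) = th.
    by apply/same/sub => q [].
  by move: s1 s2 s3 s4; case: (v p); case: (w p) => /=; intuition discriminate.
have pair p q : S p -> S q -> (impl6 (v p) (v q) = th <-> impl6 (w p) (w q) = th).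
  by move=> Sp Sq; apply: (same (Imp (Var p) (Var q))) => r [] ->.
have [all|/existsNP[p /not_implyP[Sp wp]]] := pselect (forall p, S p -> w p = v p).
  by left.
right=> q Sq.
(* At [p] the values are [nn] and [bb] in some order, so comparison with [p] settles [q]. *)
move: (orbit p Sp) (orbit q Sq) (pair p q Sp Sq) wp.
by case: (v p); case: (w p); case: (v q); case: (w q) => /=; intuition discriminate.
Qed.

Lemma models_theory_compatible Phi S v :
  models v [set a | L S a /\ consequence Phi a] ->
  exists w, models w Phi /\ forall a, L S a -> (ev v a = th <-> ev w a = th).
Proof.
move=> vPi; pose Th : set form := [set a | L S a /\ ev v a = th].
have [w wm] : exists w, models w (Phi `|` Th).
  apply: contrapT => /forallNP nomod.
  have [|G [GTh cons]] := @consequence_deduction Phi Th Bot.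
    by move=> w /nomod.
  (* This consequence of [Phi] over [S] is designated by [v], although [v] designates all of [G]. *)
  have LG : L S (Imp (delta (big_and G)) Bot).
    suff H : vars (big_and G) `<=` S by move=> p /= [[/H|/H]|].
    elim: G GTh {cons} => [|g G IH] GTh p //= [|pG].
      by have [gS _] := GTh g (or_introl erefl); apply: gS.
    by apply: IH pG => x xG; apply: GTh; right.
  have := vPi _ (conj LG cons); rewrite eval_delta_imp => H.
  by have /eval_big_and/H : models v (in_list G) by move=> g /GTh[].
exists w; split=> [g gP|a aS]; first by apply: wm; left.
split=> [va|wa]; first by apply: wm; right.
apply: contrapT => nva.
(* Non-designation of [a] is itself expressed by a formula of [Th]. *)
have : ev w (Imp (delta a) Bot) = th.
  apply: wm; right; split; first by move=> p [[/aS|/aS]|].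
  by apply/eval_delta_imp => /nva.
by move/eval_delta_imp => /(_ wa).
Qed.

Lemma consequence_interpolation Phi Psi phi :
  consequence (Phi `|` Psi) phi ->
  let S := props Phi `&` props (Psi `|` [set phi]) in
  consequence ([set a | L S a /\ consequence Phi a] `|` Psi) phi.
Proof.
move=> cons S v vm.
have [|w [wPhi same]] := @models_theory_compatible Phi S v.
  by move=> a aP; apply: vm; left.
have {w wPhi same} [w [wPhi wv]] :
    exists w, models w Phi /\ forall p, S p -> w p = v p.
  have [wv|wv] := same_theory_up_to_swap same; first by exists w.
  by exists (swap6 \o w); split=> // g /wPhi /eval_swap6.
pose u p := if `[< props Phi p >] then w p else v p.
have uw g : Phi g -> ev u g = ev w g.
  move=> gP; apply: eq_eval => p pg; rewrite /u asboolT //.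
  by exists g.
have uv g : (Psi `|` [set phi]) g -> ev u g = ev v g.
  (* A variable of [g] in [props Phi] lies in [S], where [w] and [v] agree. *)
  move=> gP; apply: eq_eval => p pg; rewrite /u; case: asboolP => // pPhi.
  by apply: wv; split=> //; exists g.
rewrite -uv; last by right.
apply: cons => g [gP|gP]; first by rewrite uw // wPhi.
by rewrite uv; [apply: vm; right|left].
Qed.

Lemma PPH_top_interpolation Phi Psi phi :
  PPH_top (Phi `|` Psi) phi ->
  exists Pi : set form,
    [/\ Pi `<=` L (props Phi `&` props (Psi `|` [set phi])),
        forall pi, Pi pi -> PPH_top Phi pi
      & PPH_top (Pi `|` Psi) phi].
Proof.
move=> /PPH_topE/consequence_interpolation cons.
eexists; split; last by apply/PPH_topE; exact: cons.
- by move=> a [].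
- by move=> a [_ /PPH_topE].
Qed.

Theorem theorem8p3 : EIP PPH_top /\ CIP PPH_top /\ MIP PPH_top.
Proof.
split; last split.
- move=> Phi Psi phi /PPH_top_interpolation[Pi [PiL PiPhi Piphi]].
  by exists Pi; split=> // a /PiL aS p /aS[].
(* Craig interpolation is the case of empty [Psi]. *)
- move=> Phi phi _; rewrite -{1}[Phi]setU0 => /PPH_top_interpolation[Pi].
  by rewrite set0U setU0; exists Pi.
- by move=> Phi Psi phi _; exact: PPH_top_interpolation.
Qed.
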